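(* For any tetrahedron $T$ in $\mathbb{R}^3$, $$\frac{\sqrt{3}}{4}<\frac{\mathrm{rad}(T)}{\mathrm{Diam}(T)}<1.$$
   Context: A tetrahedron is identified with its surface, a convex polyhedral surface in $\mathbb{R}^3$. For a convex surface $S\subset\mathbb{R}^3$, the intrinsic metric $\rho(x,y)$ is the length of a shortest path on $S$ joining $x,y\in S$; $\mathrm{Diam}(S)=\max_{x,y\in S}\rho(x,y)$ is the intrinsic diameter and $\mathrm{rad}(S)=\min_{x\in S}\max_{y\in S}\|x-y\|$ the extrinsic radius (the minimum being over points of the surface $S$), with $\|\cdot\|$ the Euclidean norm. *)

(* Defs.v *)
From HB Require Import structures.
From mathcomp Require Import all_boot all_order all_algebra.
From mathcomp Require Import all_classical all_reals all_analysis.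
Set Implicit Arguments.
Unset Strict Implicit.
Unset Printing Implicit Defensive.
Import Order.TTheory GRing.Theory Num.Theory.
Import numFieldNormedType.Exports.
Local Open Scope classical_set_scope.
Local Open Scope ring_scope.

(* The library norm [`|x|] on row vectors is the sup norm; it induces the same
   topology, but lengths and distances must use this one. *)
Definition enorm (R : realType) (n : nat) (x : 'rV[R]_n) : R :=
  Num.sqrt (\sum_(i < n) x ord0 i ^+ 2).

(* Supremum of the lengths of inscribed polygonal lines, exactly as
   [variation]/[total_variation] do for real-valued functions: the partition
   points are those of [a :: s]. *)
Definition curve_length (R : realType) (n : nat) (a b : R)
    (g : R -> 'rV[R]_n) : \bar R :=
  ereal_sup [set (\sum_(0 <= k < size s)
                   enorm (g (nth b (a :: s) k.+1) - g (nth b (a :: s) k)))%:E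
            | s in itv_partition a b].

Definition is_path (R : realType) (n : nat) (S : set 'rV[R]_n)
    (x y : 'rV[R]_n) (g : R -> 'rV[R]_n) : Prop :=
  [/\ {within `[0, 1], continuous g}, g @` `[0, 1] `<=` S, g 0 = x & g 1 = y].

(* Length of a shortest path on S, as an infimum; it is +oo when x and y are
   not joined by a rectifiable path on S. *)
Definition intrinsic_dist (R : realType) (n : nat) (S : set 'rV[R]_n)
    (x y : 'rV[R]_n) : \bar R :=
  ereal_inf [set curve_length 0 1 g | g in is_path S x y].

(* The next two are extended real numbers; [fine] sends an infinite one to 0,
   so a bound [0 < c < fine _ / fine _] also asserts that both are finite
   and nonzero. *)
Definition intrinsic_diameter (R : realType) (n : nat) (S : set 'rV[R]_n) : \bar R :=
  ereal_sup [set intrinsic_dist S p.1 p.2 | p in S `*` S].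

Definition extrinsic_radius (R : realType) (n : nat) (S : set 'rV[R]_n) : \bar R :=
  ereal_inf [set ereal_sup [set (enorm (x - y))%:E | y in S] | x in S].

Definition convex_hull (R : realType) (n : nat) (A : set 'rV[R]_n) :
    set 'rV[R]_n :=
  smallest (@convex_set R 'rV[R]_n) A.

Definition affinely_independent (R : realType) (v : 'I_4 -> 'rV[R]_3) : Prop :=
  row_free (\matrix_(i < 3) (v (lift ord0 i) - v ord0)).

(* The union of the four faces, the i-th one being opposite to v i. *)
Definition tetra_surface (R : realType) (v : 'I_4 -> 'rV[R]_3) :
    set 'rV[R]_3 :=
  \bigcup_(i in [set: 'I_4]) convex_hull [set v j | j in [set j | j != i]].

Definition is_tetrahedron (R : realType) (T : set 'rV[R]_3) : Prop :=
  exists2 v : 'I_4 -> 'rV[R]_3, affinely_independent v & T = tetra_surface v.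

(* Main.v *)
(* Fix a point [o] whose distance to the vertices is at most [r]; we join any two
   points of the surface by a path of length at most [23/10 r].  For a point [x]
   of a face and an edge [e] of that face, consider the detour
   [min_(z in e) |z - o| + |z - x|].  The key fact concerns a single triangle
   [ABC] in the ball: for every [x] in it, either the detour through [AB] is at
   most [13/10 r], or the detours through [AC] and [BC] add up to at most
   [23/10 r].  Let now [x] and [y] lie on the faces [ABC] and [ABD].  If the first
   alternative holds for one of them, crossing [AB] once is short enough since the
   other one is at distance at most [r] from [o].  Otherwise two paths are
   available, one across [ACD] and one across [BCD]; their lengths add up to at
   most [46/10 r], so one of them is short.
   Hence [Diam <= 23/10 rad < 4/sqrt 3 rad].  Conversely the midpoint of a longest
   edge shows that [rad] is less than the length of that edge, hence than [Diam]. *)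
Require Import Defs.
From HB Require Import structures.
From mathcomp Require Import all_boot all_order all_algebra.
From mathcomp Require Import ring lra.
From mathcomp Require Import all_classical all_reals all_analysis.
Import Order.TTheory GRing.Theory Num.Theory.
Import numFieldNormedType.Exports.
Local Open Scope classical_set_scope.
Local Open Scope ring_scope.
Set Implicit Arguments.
Unset Strict Implicit.
Unset Printing Implicit Defensive.

(** * Polynomial inequalities for the parameters on the sides *)

(* AM-GM: [amgm k u] bounds [sqrt u] from above, with equality at [u = k ^+ 2]. *)
Definition amgm (R : fieldType) (k u : R) := (u / k + k) / 2.

(* For [A], [B] in the unit ball and [X = |A - B|^2], an upper bound of
   [|(1 - s) A + s B|^2]. *)
Definition chord (R : fieldType) (s X : R) := 1 - s * (1 - s) * X.

(* The squared distance between the points with parameters [s] and [t] on the sides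
   [AB] and [AC] of a triangle, in terms of [X = |AB|^2], [Y = |BC|^2] and
   [Z = |CA|^2]. *)
Definition cross (R : fieldType) (t s X Y Z : R) :=
  t * (t - s) * Z + s * (s - t) * X + t * s * Y.

(* The parameters [t], [s], [q] locate points on the sides [AC], [AB], [CB].  Once
   they and the [k]'s are fixed, the two bounds are affine in [(X, Y, Z)], so each
   choice settles a polyhedron; the choices below, in units of 1/20, were found by
   computer search so that these polyhedra cover the whole domain. *)
Lemma good_parameters (R : realFieldType) (X Y Z : R) :
    0 <= X -> 0 <= Y -> 0 <= Z <= 4 -> X + Y + Z <= 9 ->
  exists t s q : R, [/\ 0 <= t <= 1, 0 <= s <= 1, 0 <= q <= 1 &
  exists k1 k2 k3 k4 k5 : R,
    [/\ [/\ 0 < k1, 0 < k2, 0 < k3, 0 < k4 & 0 < k5],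
    amgm k1 (chord s X) + amgm k2 (cross t s X Y Z) <= 13 / 10 &
    amgm k3 (chord t Z) + amgm k4 (chord q Y)
      + amgm k5 (cross (1 - t) q Y X Z) <= 23 / 10]].
Proof.
move=> X0 Y0 /andP[Z0 Z4] XYZ9; apply: contrapT => none.
pose c n : R := n%:R / 20.
(* With numerators as arguments, the side conditions are decided by computation. *)
have fails (t s q k1 k2 k3 k4 k5 : nat) :
    [&& t <= 20, s <= 20, q <= 20, 0 < k1, 0 < k2, 0 < k3, 0 < k4 & 0 < k5]%N ->
    13 / 10 < amgm (c k1) (chord (c s) X)
                  + amgm (c k2) (cross (c t) (c s) X Y Z) \/
    23 / 10 < amgm (c k3) (chord (c t) Z) + amgm (c k4) (chord (c q) Y)
                  + amgm (c k5) (cross (1 - c t) (c q) Y X Z).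
  have c01 n : (n <= 20)%N -> 0 <= c n <= 1.
    by rewrite /c -(ler_nat R) => n20; rewrite divr_ge0//= ler_pdivrMr// mul1r.
  have c0 n : (0 < n)%N -> 0 < c n by move=> n0; rewrite divr_gt0// ltr0n.
  move=> /and5P[tle sle qle k1p /and4P[k2p k3p k4p k5p]].
  case: (ltrP (13 / 10)) => [|P]; first by left.
  case: (ltrP (23 / 10)) => [|Q]; first by right.
  case: none; exists (c t), (c s), (c q); split; try exact: c01.
  by exists (c k1), (c k2), (c k3), (c k4), (c k5); split => //; split; exact: c0.
rewrite /amgm /chord /cross /c {c none} in fails.
(* Each call branches on which of the two bounds fails. On every leaf the failed bounds, linear in
   [X], [Y], [Z], contradict the hypotheses. *)
case: (fails 13 7 3 15 9 18 18 7 isT) => ?.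
  case: (fails 4 2 8 19 4 19 16 11 isT) => ?.
    case: (fails 3 3 12 19 5 16 11 15 isT) => ?.
      by case: (fails 2 0 13 20 2 19 14 6 isT); lra.
    case: (fails 4 5 12 18 6 14 13 18 isT) => ?; first by lra.
    by case: (fails 5 6 12 17 8 12 13 16 isT); lra.
  case: (fails 11 10 7 16 8 15 19 11 isT) => ?; last by lra.
  case: (fails 7 6 10 18 7 16 17 12 isT) => ?.
    case: (fails 5 5 11 18 6 16 15 13 isT) => ?.
      case: (fails 4 5 12 18 6 14 13 18 isT) => ?; last by lra.
      by case: (fails 3 3 12 19 5 16 11 15 isT); lra.
    case: (fails 6 5 9 17 8 16 15 15 isT) => ?.
      by case: (fails 5 6 12 17 8 12 13 16 isT); lra.
    by case: (fails 7 8 13 19 6 18 18 6 isT) => ?; case: (fails 7 8 11 16 9 13 16 15 isT); lra.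
  case: (fails 9 7 7 16 9 16 17 12 isT) => ?.
    case: (fails 8 6 8 17 9 16 15 13 isT) => ?.
      case: (fails 6 5 9 17 8 16 15 15 isT) => ?; first by lra.
      by case: (fails 7 8 11 16 9 13 16 15 isT) => ?; case: (fails 8 6 8 15 11 15 13 14 isT); lra.
    by case: (fails 8 7 9 18 8 16 17 11 isT); lra.
  case: (fails 10 7 6 17 9 17 18 10 isT) => ?; first by lra.
  by case: (fails 12 9 5 14 11 15 18 10 isT); lra.
case: (fails 17 13 0 15 6 18 20 4 isT) => ?; last by lra.
case: (fails 12 9 5 14 11 15 18 10 isT) => ?; first by lra.
by case: (fails 15 4 0 18 4 20 20 2 isT) => ?; case: (fails 15 8 1 17 7 19 20 4 isT); lra.
Qed.

(** * Euclidean scalar product and norm *)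

Definition dotr (R : realType) n (x y : 'rV[R]_n) : R :=
  \sum_(i < n) x ord0 i * y ord0 i.

Lemma dotr_lincomb (R : realType) n (a b : R) (x y : 'rV[R]_n) :
  dotr (a *: x + b *: y) (a *: x + b *: y)
    = a ^+ 2 * dotr x x + 2 * a * b * dotr x y + b ^+ 2 * dotr y y.
Proof.
rewrite /dotr !mulr_sumr -!big_split/=; apply: eq_bigr => i _.
by rewrite !mxE; ring.
Qed.

Lemma dotr_ge0 (R : realType) n (x : 'rV[R]_n) : 0 <= dotr x x.
Proof. by apply: sumr_ge0 => i _; rewrite -expr2 sqr_ge0. Qed.

Lemma enormE (R : realType) n (x : 'rV[R]_n) : enorm x = Num.sqrt (dotr x x).
Proof. by rewrite /enorm /dotr; under eq_bigr do rewrite expr2. Qed.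

Lemma sqr_enorm (R : realType) n (x : 'rV[R]_n) : enorm x ^+ 2 = dotr x x.
Proof. by rewrite enormE sqr_sqrtr// dotr_ge0. Qed.

Lemma enorm_ge0 (R : realType) n (x : 'rV[R]_n) : 0 <= enorm x.
Proof. exact: sqrtr_ge0. Qed.

Lemma enormZ (R : realType) n (a : R) (x : 'rV[R]_n) :
  enorm (a *: x) = `|a| * enorm x.
Proof.
rewrite !enormE -sqrtr_sqr -sqrtrM ?sqr_ge0//; congr Num.sqrt.
by rewrite /dotr mulr_sumr; apply: eq_bigr => i _; rewrite !mxE; ring.
Qed.

Lemma enorm0 (R : realType) n : enorm (0 : 'rV[R]_n) = 0.
Proof. by rewrite -(scale0r (0 : 'rV[R]_n)) enormZ normr0 mul0r. Qed.

Lemma enormN (R : realType) n (x : 'rV[R]_n) : enorm (- x) = enorm x.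
Proof. by rewrite -scaleN1r enormZ normrN1 mul1r. Qed.

Lemma enormBC (R : realType) n (x y : 'rV[R]_n) : enorm (x - y) = enorm (y - x).
Proof. by rewrite -opprB enormN. Qed.

Lemma enorm_eq0 (R : realType) n (x : 'rV[R]_n) : enorm x = 0 -> x = 0.
Proof.
move=> x0; have /eqP := sqr_enorm x; rewrite x0 expr0n/= eq_sym.
rewrite psumr_eq0 => [/allP xi0|i _]; last by rewrite -expr2 sqr_ge0.
apply/rowP => i; rewrite mxE; apply/eqP.
by rewrite -[_ == _]orbb -mulf_eq0; apply: (xi0 i); rewrite mem_index_enum.
Qed.

(* The discriminant of the nonnegative quadratic form [|a x + b y|^2]. *)
Lemma dotr_le_enorm (R : realType) n (x y : 'rV[R]_n) :
  dotr x y <= enorm x * enorm y.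
Proof.
have := dotr_ge0 (enorm y *: x + - enorm x *: y).
have [x0|] := eqVneq (enorm x) 0.
  by move=> _; rewrite x0 (enorm_eq0 x0) /dotr big1 ?mul0r// => i _; rewrite mxE mul0r.
have [y0|] := eqVneq (enorm y) 0.
  by move=> _ _; rewrite y0 (enorm_eq0 y0) /dotr big1 ?mulr0// => i _; rewrite mxE mulr0.
rewrite dotr_lincomb -!sqr_enorm => ny0 nx0.
have {nx0} x0 : 0 < enorm x by rewrite lt_neqAle eq_sym nx0 enorm_ge0.
have {ny0} y0 : 0 < enorm y by rewrite lt_neqAle eq_sym ny0 enorm_ge0.
have -> : enorm y ^+ 2 * enorm x ^+ 2 + 2 * enorm y * - enorm x * dotr x y
    + (- enorm x) ^+ 2 * enorm y ^+ 2
  = (2 * (enorm x * enorm y)) * (enorm x * enorm y - dotr x y) by ring.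
by rewrite pmulr_rge0 ?subr_ge0// mulr_gt0// mulr_gt0.
Qed.

Lemma ler_enormD (R : realType) n (x y : 'rV[R]_n) :
  enorm (x + y) <= enorm x + enorm y.
Proof.
rewrite -(@ler_pXn2r _ 2)// ?nnegrE ?addr_ge0 ?enorm_ge0// sqr_enorm.
have := dotr_lincomb 1 1 x y; rewrite !scale1r => ->.
by rewrite sqrrD !sqr_enorm; have := dotr_le_enorm x y; lra.
Qed.

Lemma ler_enormB (R : realType) n (x y z : 'rV[R]_n) :
  enorm (x - z) <= enorm (x - y) + enorm (y - z).
Proof. by have := ler_enormD (x - y) (y - z); rewrite addrA subrK. Qed.

(** * Affine interpolation *)

Definition lerp (R : realType) n (t : R) (x y : 'rV[R]_n) :=
  (1 - t) *: x + t *: y.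

Lemma lerp0 (R : realType) n (x y : 'rV[R]_n) : lerp 0 x y = x.
Proof. by rewrite /lerp subr0 scale1r scale0r addr0. Qed.

Lemma lerp1 (R : realType) n (x y : 'rV[R]_n) : lerp 1 x y = y.
Proof. by rewrite /lerp subrr scale1r scale0r add0r. Qed.

Lemma lerpB (R : realType) n (t : R) (x y x' y' : 'rV[R]_n) :
  lerp t x y - lerp t x' y' = lerp t (x - x') (y - y').
Proof. by apply/rowP => i; rewrite !mxE; ring. Qed.

Lemma enorm_lerp (R : realType) n (t : R) (x y : 'rV[R]_n) : 0 <= t <= 1 ->
  enorm (lerp t x y) <= (1 - t) * enorm x + t * enorm y.
Proof.
move=> /andP[t0 t1]; apply: (le_trans (ler_enormD _ _)).
by rewrite !enormZ !ger0_norm// subr_ge0.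
Qed.

(** Stewart's theorem for the triangle with vertices [x], [y] and the origin. *)
Lemma sqr_enorm_lerp (R : realType) n (t : R) (x y : 'rV[R]_n) :
  enorm (lerp t x y) ^+ 2 = (1 - t) * enorm x ^+ 2 + t * enorm y ^+ 2
                            - t * (1 - t) * enorm (x - y) ^+ 2.
Proof.
rewrite !sqr_enorm /dotr !mulr_sumr -sumrN -!big_split/=.
by apply: eq_bigr => i _; rewrite !mxE; ring.
Qed.

(** The law of cosines at [x], with the angle expressed by the three sides; the right-hand side is
    [cross t s] of the squared sides. *)
Lemma sqr_enorm_lerpB (R : realType) n (s t : R) (x y z : 'rV[R]_n) :
  enorm (lerp s x y - lerp t x z) ^+ 2 = t * (t - s) * enorm (z - x) ^+ 2
    + s * (s - t) * enorm (x - y) ^+ 2 + t * s * enorm (y - z) ^+ 2.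
Proof.
rewrite !sqr_enorm /dotr !mulr_sumr -!big_split/=.
by apply: eq_bigr => i _; rewrite !mxE; ring.
Qed.

(** * Lipschitz paths *)

(* A path of length at most [L] in [S], parametrized so as to be 1-Lipschitz
   on the whole line. *)
Definition reach (R : realType) n (S : set 'rV[R]_n) (L : R) (x y : 'rV[R]_n) :=
  exists g : R -> 'rV[R]_n, [/\ g 0 = x, g L = y, forall s, S (g s) &
    forall s t, enorm (g t - g s) <= `|t - s|].

Definition clamp (R : realType) (s : R) := Num.max 0 (Num.min 1 s).

Lemma clampP (R : realType) (s : R) :
  [\/ s <= 0 /\ clamp s = 0, 0 <= s <= 1 /\ clamp s = s |
      1 <= s /\ clamp s = 1].
Proof.
rewrite /clamp; have [s0|s0] := leP s 0.
  by constructor 1; rewrite min_r ?max_l//; lra.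
have [s1|s1] := leP s 1; last by constructor 3; rewrite max_r//; lra.
by constructor 2; rewrite max_r ltW.
Qed.

Lemma clamp_itv (R : realType) (s : R) : 0 <= clamp s <= 1.
Proof. by case: (clampP s) => -[? ->]; rewrite ?lexx ?ler01. Qed.

Lemma clamp_lip (R : realType) (s t : R) : `|clamp t - clamp s| <= `|t - s|.
Proof.
wlog st : s t / s <= t => [h|].
  by have [/h//|/ltW/h] := leP s t; rewrite distrC (distrC t).
rewrite (ger0_norm (_ : 0 <= t - s)) ?subr_ge0//.
by case: (clampP s) => -[? ->]; case: (clampP t) => -[? ->]; rewrite ger0_norm; lra.
Qed.

(** The segment is run at constant speed [|y - x| / L <= 1], and [clamp] stops the motion outside
    [[0, L]]. *)
Lemma reach_lerp (R : realType) n (S : set 'rV[R]_n) (L : R) x y :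
    (forall t, 0 <= t <= 1 -> S (lerp t x y)) -> enorm (y - x) <= L ->
  reach S L x y.
Proof.
move=> xyS xyL; exists (fun s => lerp (clamp (s / L)) x y); split.
- by rewrite mul0r /clamp min_r// max_r// lerp0.
(* For [L = 0] the endpoints coincide, so the value of [L / L] is irrelevant. *)
- have := le_trans (enorm_ge0 _) xyL; rewrite le_eqVlt => /predU1P[L0|L0].
    suff -> : y = x by apply/rowP => i; rewrite !mxE; ring.
    apply/eqP; rewrite -subr_eq0; apply/eqP/enorm_eq0/eqP.
    by rewrite eq_le enorm_ge0 andbT L0.
  by rewrite divff ?gt_eqF// /clamp minxx max_r// lerp1.
- by move=> s; apply: xyS; exact: clamp_itv.
- move=> s t.
  have -> : lerp (clamp (t / L)) x y - lerp (clamp (s / L)) x y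
      = (clamp (t / L) - clamp (s / L)) *: (y - x).
    by apply/rowP => i; rewrite !mxE; ring.
  rewrite enormZ; have L0 := le_trans (enorm_ge0 _) xyL.
  apply: (@le_trans _ _ (`|t / L - s / L| * L)).
    by rewrite ler_pM ?enorm_ge0//; exact: clamp_lip.
  rewrite -mulrBl normrM (ger0_norm (_ : 0 <= L^-1)) ?invr_ge0// -mulrA.
  by have [->|L1] := eqVneq L 0; [rewrite mulr0 mulr0|rewrite mulVf ?mulr1].
Qed.

Lemma reach_cat (R : realType) n (S : set 'rV[R]_n) (L M : R) x y z :
  0 <= L -> 0 <= M -> reach S L x y -> reach S M y z -> reach S (L + M) x z.
Proof.
move=> L0 M0 [g [g0 gL gS glip]] [h [h0 hM hS hlip]].
exists (fun s => if s <= L then g s else h (s - L)); split.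
- by rewrite L0.
- case: ifPn => [|_]; last by rewrite addrC addKr.
  (* The first branch applies at time [L + M] only if [M = 0], and then [y = z]. *)
  rewrite gerDl => M0'; have {}M0 : M = 0 by apply/eqP; rewrite eq_le M0' M0.
  by rewrite M0 addr0 gL -h0 -hM M0.
- by move=> s; case: ifP.
(* Times on either side of [L] are compared through [y], the point at time [L]. *)
- have mixed s t : s <= L -> L < t -> enorm (h (t - L) - g s) <= t - s.
    move=> sL Lt; apply: (le_trans (ler_enormB _ y _)).
    rewrite -{1}h0 -gL; have := glip s L; have := hlip 0 (t - L).
    by rewrite subr0 !ger0_norm; lra.
  move=> s t; have [tL|tL] := leP t L; have [sL|sL] := leP s L.
  + exact: glip.
  + by rewrite enormBC distrC ger0_norm ?mixed//; lra.
  + by rewrite ger0_norm ?mixed//; lra.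
  + by apply: (le_trans (hlip _ _)); rewrite opprB addrA subrK.
Qed.

(** * Curve length and intrinsic distance *)

(** Continuity refers to the sup norm, so Lipschitz bounds for [enorm] have to be transferred to
    it. *)
Lemma norm_le_enorm (R : realType) n (x : 'rV[R]_n) : `|x| <= enorm x.
Proof.
rewrite {1}/Num.norm/= mx_normrE; apply/bigmax_leP; split; first exact: enorm_ge0.
move=> [i j] _ /=; rewrite (ord1 i) -sqrtr_sqr enormE ler_wsqrtr//.
by rewrite /dotr (bigD1 j)//= -expr2 lerDl sumr_ge0// => k _; rewrite -expr2 sqr_ge0.
Qed.

(** Along any partition of [[0, 1]] the Lipschitz bounds telescope to [L]. *)
Lemma curve_length_le (R : realType) n (L : R) (g : R -> 'rV[R]_n) :
    (forall s t, enorm (g t - g s) <= L * `|t - s|) ->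
  (curve_length 0 1 g <= L%:E)%E.
Proof.
move=> glip; apply: ge_ereal_sup => _ [s [s_path /eqP s_last] <-].
rewrite lee_fin; pose t k := nth 1 (0 :: s) k.
apply: (@le_trans _ _ (\sum_(0 <= k < size s) L * (t k.+1 - t k))).
  rewrite !big_nat; apply: ler_sum => k /andP[_ ks].
  apply: (le_trans (glip _ _)).
  by rewrite /t ger0_norm// subr_ge0 ltW//; exact: (pathP 1 s_path).
rewrite -mulr_sumr telescope_sumr// {2}/t /= subr0.
by rewrite /t (last_nth 1) in s_last *; rewrite s_last mulr1.
Qed.

Lemma curve_length_ge (R : realType) n (g : R -> 'rV[R]_n) :
  ((enorm (g 1 - g 0))%:E <= curve_length 0 1 g)%E.
Proof.
(* The one-piece partition; its initial point 0 is implicit. *)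
apply: ereal_sup_ubound; exists [:: 1]; last by rewrite /= big_nat1.
by apply: itv_partition1; exact: ltr01.
Qed.

Lemma reach_dist (R : realType) n (S : set 'rV[R]_n) (L : R) x y :
  0 <= L -> reach S L x y -> (intrinsic_dist S x y <= L%:E)%E.
Proof.
move=> L0 [g [g0 gL gS glip]]; pose h s := g (L * s).
have hlip s t : enorm (h t - h s) <= L * `|t - s|.
  by apply: (le_trans (glip _ _)); rewrite -mulrBr normrM ger0_norm.
apply: (le_trans _ (curve_length_le hlip)); apply: ereal_inf_lbound.
exists h => //; split; last 2 first.
- by rewrite /h mulr0.
- by rewrite /h mulr1.
- apply: continuous_subspaceT => s; apply/cvgrPdist_le => e e0.
  (* As [L] may be 0, the division below is by [L + 1]. *)
  have L1 : 0 < L + 1 by lra.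
  near=> t; apply: (le_trans (norm_le_enorm _)); apply: (le_trans (hlip _ _)).
  apply: (@le_trans _ _ ((L + 1) * `|s - t|)).
    by rewrite ler_wpM2r//; lra.
  rewrite mulrC -ler_pdivlMr//; near: t.
  have := @cvg_id _ (nbhs s) => /cvgrPdist_le; apply; exact: divr_gt0.
- by move=> _ [s _ <-]; exact: gS.
Unshelve. all: by end_near. Qed.

Lemma dist_ge (R : realType) n (S : set 'rV[R]_n) x y :
  ((enorm (x - y))%:E <= intrinsic_dist S x y)%E.
Proof.
apply/ereal_infP => _ [g [_ _ <- <-] <-].
by rewrite enormBC; exact: curve_length_ge.
Qed.

(** * Points on the sides of a triangle in the unit ball *)

(** From [(e - k)^2 >= 0] one gets [2 e k <= e^2 + k^2 <= u + k^2]. *)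
Lemma le_amgm (R : realType) (k u e : R) : 0 < k -> e ^+ 2 <= u -> e <= amgm k u.
Proof.
move=> k0 eu; rewrite /amgm ler_pdivlMr// -(ler_pM2r k0) mulrDl divfK ?gt_eqF//.
by have := sqr_ge0 (e - k); rewrite sqrrB; lra.
Qed.

(** Geometric form of [good_parameters], with [o] at the origin and [r = 1]: each distance is
    bounded by [amgm] of a bound on its square. *)
Lemma side_point (R : realType) n (A B C : 'rV[R]_n) :
    enorm A <= 1 -> enorm B <= 1 -> enorm C <= 1 ->
  exists t s q : R, [/\ 0 <= t <= 1, 0 <= s <= 1, 0 <= q <= 1,
    enorm (lerp s A B) + enorm (lerp s A B - lerp t A C) <= 13 / 10 &
    enorm (lerp t A C)
      + (enorm (lerp q C B) + enorm (lerp q C B - lerp t A C)) <= 23 / 10].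
Proof.
move=> A1 B1 C1.
have sqr_le1 (x : 'rV[R]_n) : enorm x <= 1 -> enorm x ^+ 2 <= 1.
  by move=> x1; rewrite expr_le1// enorm_ge0.
pose X := enorm (A - B) ^+ 2; pose Y := enorm (B - C) ^+ 2.
pose Z := enorm (C - A) ^+ 2.
have XYZ9 : X + Y + Z <= 9.
  have -> : X + Y + Z = 3 * (enorm A ^+ 2 + enorm B ^+ 2 + enorm C ^+ 2)
      - enorm (A + B + C) ^+ 2.
    rewrite /X /Y /Z !sqr_enorm /dotr -!big_split/= mulr_sumr -sumrB.
    by apply: eq_bigr => i _; rewrite !mxE; ring.
  have := sqr_le1 A A1; have := sqr_le1 B B1; have := sqr_le1 C C1.
  by have := sqr_ge0 (enorm (A + B + C)); lra.
have Z4 : 0 <= Z <= 4.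
  rewrite sqr_ge0/=.
  have -> : 4 = 2 ^+ 2 :> R by ring.
  rewrite ler_pXn2r ?nnegrE ?enorm_ge0//.
  by have := ler_enormD C (- A); rewrite enormN; lra.
have chordE (a b : 'rV[R]_n) (s : R) : enorm a <= 1 -> enorm b <= 1 -> 0 <= s <= 1 ->
    enorm (lerp s a b) ^+ 2 <= chord s (enorm (a - b) ^+ 2).
  move=> /sqr_le1 a1 /sqr_le1 b1 /andP[s0 s1].
  by rewrite sqr_enorm_lerp /chord lerB//; nra.
have [t [s [q [t01 s01 q01]]]] := good_parameters (sqr_ge0 _ : 0 <= X) (sqr_ge0 _ : 0 <= Y) Z4 XYZ9.
move=> [k1 [k2 [k3 [k4 [k5 [[k1p k2p k3p k4p k5p] P Q]]]]]].
exists t, s, q; split => //.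
  apply: (le_trans _ P); apply: lerD; apply: le_amgm => //; first exact: chordE.
  by rewrite sqr_enorm_lerpB.
apply: (le_trans _ Q); rewrite addrA; apply: lerD.
  apply: lerD; apply: le_amgm => //; first by rewrite /Z enormBC chordE.
  by rewrite /Y enormBC chordE.
(* Both sides now issue from [C], so the point of [AC] has parameter [1 - t]. *)
apply: le_amgm => //; have -> : lerp t A C = lerp (1 - t) C A.
  by apply/rowP => i; rewrite !mxE; ring.
by rewrite sqr_enorm_lerpB (enormBC A C) (enormBC C B) (enormBC B A).
Qed.

(** * Segments, triangles and convexity *)

Definition segment (R : realType) n (A B x : 'rV[R]_n) :=
  exists2 t, 0 <= t <= 1 & x = lerp t A B.

Definition triangle (R : realType) n (A B C x : 'rV[R]_n) :=
  exists a b c, [/\ 0 <= a, 0 <= b, 0 <= c, a + b + c = 1 &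
                    x = a *: A + b *: B + c *: C].

Definition lerp_closed (R : realType) n (S : 'rV[R]_n -> Prop) :=
  forall t x y, 0 <= t <= 1 -> S x -> S y -> S (lerp t x y).

Lemma segmentC (R : realType) n (A B x : 'rV[R]_n) :
  segment A B x -> segment B A x.
Proof.
move=> [t t01 ->]; exists (1 - t); first by lra.
by apply/rowP => i; rewrite !mxE; ring.
Qed.

Lemma segment_l (R : realType) n (A B : 'rV[R]_n) : segment A B A.
Proof. by exists 0; rewrite ?lexx ?ler01 ?lerp0. Qed.

Lemma segment_r (R : realType) n (A B : 'rV[R]_n) : segment A B B.
Proof. exact/segmentC/segment_l. Qed.

Lemma segment_closed (R : realType) n (A B : 'rV[R]_n) :
  lerp_closed (segment A B).
Proof.
move=> t x y /andP[t0 t1] [a /andP[a0 a1] ->] [b /andP[b0 b1] ->].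
exists ((1 - t) * a + t * b); last by apply/rowP => i; rewrite !mxE; ring.
by apply/andP; split; nra.
Qed.

Lemma triangle_closed (R : realType) n (A B C : 'rV[R]_n) :
  lerp_closed (triangle A B C).
Proof.
move=> t x y /andP[t0 t1] [a [b [c [a0 b0 c0 abc ->]]]].
move=> [a' [b' [c' [a'0 b'0 c'0 abc' ->]]]].
exists ((1 - t) * a + t * a'), ((1 - t) * b + t * b'), ((1 - t) * c + t * c').
split; [nra|nra|nra| |by apply/rowP => i; rewrite !mxE; ring].
by transitivity ((1 - t) * (a + b + c) + t * (a' + b' + c'));
  [ring|rewrite abc abc'; ring].
Qed.

(** Unless [a + b = 0], where [x = C], the point [x] lies between [C] and a point of [AB], so
    convexity is used twice. *)
Lemma triangle_sub (R : realType) n (S : 'rV[R]_n -> Prop) A B C x :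
  lerp_closed S -> S A -> S B -> S C -> triangle A B C x -> S x.
Proof.
move=> Scl SA SB SC [a [b [c [a0 b0 c0 abc ->]]]].
have [ab0|ab0] := eqVneq (a + b) 0.
  have [-> -> ->] : [/\ a = 0, b = 0 & c = 1] by split; lra.
  by rewrite !scale0r !add0r scale1r.
have ab1 : 0 < a + b by rewrite lt_neqAle eq_sym ab0 addr_ge0.
have -> : a *: A + b *: B + c *: C = lerp c (lerp (b / (a + b)) A B) C.
  have -> : c = 1 - (a + b) by lra.
  by apply/rowP => i; rewrite !mxE; field.
apply: (Scl) => //; first by lra.
apply: Scl => //; rewrite divr_ge0 ?addr_ge0//= ler_pdivrMr//; lra.
Qed.

Lemma triangleACB (R : realType) n (A B C x : 'rV[R]_n) :
  triangle A B C x -> triangle A C B x.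
Proof.
move=> [a [b [c [a0 b0 c0 abc ->]]]]; exists a, c, b.
by split => //; [lra|rewrite addrAC].
Qed.

Lemma triangleBAC (R : realType) n (A B C x : 'rV[R]_n) :
  triangle A B C x -> triangle B A C x.
Proof.
move=> [a [b [c [a0 b0 c0 abc ->]]]]; exists b, a, c.
by split => //; [lra|rewrite (addrC (b *: B))].
Qed.

Lemma segment_triangle (R : realType) n (A B C x : 'rV[R]_n) :
  segment A B x -> triangle A B C x.
Proof.
move=> [t /andP[t0 t1] ->]; exists (1 - t), t, 0.
by split; rewrite ?subr_ge0// ?subrK ?addr0// scale0r addr0.
Qed.

(** The cevian [Aq] cuts the triangle in two; comparing [c / b] with the ratio [t / (1 - t)] at [q]
    tells on which side [x] lies. *)
Lemma triangle_split (R : realType) n (A B C q x : 'rV[R]_n) :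
    segment B C q -> triangle A B C x ->
  triangle A B q x \/ triangle A q C x.
Proof.
move=> [t /andP[t0 t1] ->] [a [b [c [a0 b0 c0 abc ->]]]].
have [h|h] := leP (c * (1 - t)) (b * t); [left|right].
  (* If [t = 0] then [q = B], and the comparison forces [x] onto [AB]. *)
  have [t_0|tn0] := eqVneq t 0.
    have c_0 : c = 0 by rewrite t_0 in h; lra.
    exists a, b, 0; split => //; first by rewrite -c_0.
    by rewrite c_0 !scale0r.
  have tp : 0 < t by rewrite lt_neqAle eq_sym tn0.
  exists a, (b - c / t * (1 - t)), (c / t); split => //.
  - by rewrite subr_ge0 mulrAC ler_pdivrMr.
  - by rewrite divr_ge0.
  - by rewrite -[RHS]abc; field.
  - by apply/rowP => i; rewrite !mxE; field.
have tp : 0 < 1 - t by rewrite lt_neqAle subr_ge0 t1 andbT; apply/eqP => t_1; nra.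
exists a, (b / (1 - t)), (c - b / (1 - t) * t); split => //.
- by rewrite divr_ge0// ltW.
- by rewrite subr_ge0 mulrAC ler_pdivrMr// ltW.
- by rewrite -[RHS]abc; field; rewrite gt_eqF.
- by apply/rowP => i; rewrite !mxE; field; rewrite gt_eqF.
Qed.

(** * Detours through the sides of a triangle *)

(** A crossing point [w] is exhibited in place of a minimum over the side, which makes convexity in
    [x] easy to prove. *)
Definition near_side (R : realType) n (o : 'rV[R]_n) (d : R) A B x :=
  exists2 w, segment A B w & enorm (w - o) + enorm (w - x) <= d.

Definition near_two_sides (R : realType) n (o : 'rV[R]_n) (d : R) A B C x :=
  exists u v, [/\ segment B C u, segment A C v &
    enorm (u - o) + enorm (u - x) + (enorm (v - o) + enorm (v - x)) <= d].

(** Joint convexity of [|w - o| + |w - x|] in [(w, x)]; it makes both detour conditions convex in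
    [x]. *)
Lemma lerp_sum_le (R : realType) n (t : R) (o w x w' x' : 'rV[R]_n) :
    0 <= t <= 1 ->
  enorm (lerp t w w' - o) + enorm (lerp t w w' - lerp t x x')
    <= (1 - t) * (enorm (w - o) + enorm (w - x))
       + t * (enorm (w' - o) + enorm (w' - x')).
Proof.
move=> t01; have -> : lerp t w w' - o = lerp t (w - o) (w' - o).
  by apply/rowP => i; rewrite !mxE; ring.
rewrite lerpB; have := enorm_lerp (w - o) (w' - o) t01.
by have := enorm_lerp (w - x) (w' - x') t01; lra.
Qed.

Lemma near_side_closed (R : realType) n (o : 'rV[R]_n) (d : R) A B :
  lerp_closed (near_side o d A B).
Proof.
move=> t x y t01 [w ABw wd] [w' ABw' wd']; exists (lerp t w w').
  exact: segment_closed.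
by apply: (le_trans (lerp_sum_le _ _ _ _ _ t01)); case/andP: t01; nra.
Qed.

Lemma near_two_sides_closed (R : realType) n (o : 'rV[R]_n) (d : R) A B C :
  lerp_closed (near_two_sides o d A B C).
Proof.
move=> t x y t01 [u [v [BCu ACv uvd]]] [u' [v' [BCu' ACv' uvd']]].
exists (lerp t u u'), (lerp t v v'); split; try exact: segment_closed.
have := lerp_sum_le o u x u' y t01; have := lerp_sum_le o v x v' y t01.
by case/andP: t01; nra.
Qed.

(** As [p] lies on [AC], its detour through [AC] costs just [|p - o|]; the last bound is thus the
    second alternative for [p]. *)
Lemma side_point_near (R : realType) n (o A B C : 'rV[R]_n) (r : R) : 0 < r ->
    enorm (A - o) <= r -> enorm (B - o) <= r -> enorm (C - o) <= r ->
  exists p, [/\ segment A C p, near_side o (13 / 10 * r) A B p &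
    exists2 z, segment B C z & enorm (p - o)
      + (enorm (z - o) + enorm (z - p)) <= 23 / 10 * r].
Proof.
(* The similarity [f] maps the ball of radius [r] about [o] to the unit ball. *)
move=> r0 Ar Br Cr; pose f (x : 'rV[R]_n) := r^-1 *: (x - o).
have f1 x : enorm (x - o) <= r -> enorm (f x) <= 1.
  move=> xr; rewrite enormZ ger0_norm ?invr_ge0 ?(ltW r0)//.
  by rewrite mulrC ler_pdivrMr// mul1r.
have fB x y : enorm (f x - f y) = enorm (x - y) / r.
  rewrite -scalerBr opprB addrA subrK enormZ ger0_norm ?invr_ge0 ?(ltW r0)//.
  by rewrite mulrC.
have f0 x : enorm (f x) = enorm (x - o) / r.
  by rewrite enormZ ger0_norm ?invr_ge0 ?(ltW r0)// mulrC.
have flerp t x y : lerp t (f x) (f y) = f (lerp t x y).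
  by apply/rowP => i; rewrite !mxE; ring.
have [t [s [q []]]] := side_point (f1 _ Ar) (f1 _ Br) (f1 _ Cr).
rewrite !flerp !fB !f0 -!mulrDl !ler_pdivrMr// => t01 s01 q01 P Q.
exists (lerp t A C); split; first by exists t.
  by exists (lerp s A B) => //; exists s.
by exists (lerp q C B) => //; apply: segmentC; exists q.
Qed.

(* Both alternatives describe convex sets: the first contains [A], [B], the
   second contains [C], and both contain the points [p] and [q] given by
   [side_point_near] on the sides [AC] and [BC]. So the first one covers the
   triangles [ABq] and [Aqp], the second one the triangle [pqC]. *)
Lemma triangle_near (R : realType) n (o A B C x : 'rV[R]_n) (r : R) : 0 < r ->
    enorm (A - o) <= r -> enorm (B - o) <= r -> enorm (C - o) <= r ->
    triangle A B C x ->
  near_side o (13 / 10 * r) A B x \/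
  near_two_sides o (23 / 10 * r) A B C x.
Proof.
move=> r0 Ar Br Cr ABCx.
have [p [ACp ABp [z BCz pz]]] := side_point_near r0 Ar Br Cr.
have [q [BCq BAq [z' ACz' qz']]] := side_point_near r0 Br Ar Cr.
have sideA : near_side o (13 / 10 * r) A B A.
  by exists A; [exact: segment_l|rewrite subrr enorm0; lra].
have sideB : near_side o (13 / 10 * r) A B B.
  by exists B; [exact: segment_r|rewrite subrr enorm0; lra].
have sideq : near_side o (13 / 10 * r) A B q.
  by move: BAq => [w BAw wd]; exists w => //; exact: segmentC.
have twoC : near_two_sides o (23 / 10 * r) A B C C.
  exists C, C; split; try exact: segment_r.
  by rewrite subrr enorm0; lra.
have twop : near_two_sides o (23 / 10 * r) A B C p.
  by exists z, p; split => //; rewrite (subrr p) enorm0; lra.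
have twoq : near_two_sides o (23 / 10 * r) A B C q.
  by exists q, z'; split => //; rewrite (subrr q) enorm0; lra.
have [|/triangleBAC qACx] := triangle_split BCq ABCx.
  by left; apply: triangle_sub a; first exact: near_side_closed.
have [|] := triangle_split ACp qACx.
  by left; apply: triangle_sub a; first exact: near_side_closed.
by right; apply: triangle_sub b; first exact: near_two_sides_closed.
Qed.

Lemma triangle_ball (R : realType) n (o A B C x : 'rV[R]_n) (r : R) :
    enorm (A - o) <= r -> enorm (B - o) <= r -> enorm (C - o) <= r ->
  triangle A B C x -> enorm (x - o) <= r.
Proof.
apply: (@triangle_sub _ _ (fun y => enorm (y - o) <= r)) => t y z t01 yr zr.
have -> : lerp t y z - o = lerp t (y - o) (z - o).
  by apply/rowP => i; rewrite !mxE; ring.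
by apply: (le_trans (enorm_lerp _ _ t01)); case/andP: t01; nra.
Qed.

(** * Paths between adjacent faces *)

Lemma reach_triangle (R : realType) n (S : set 'rV[R]_n) (L : R) A B C x y :
    triangle A B C `<=` S -> triangle A B C x -> triangle A B C y ->
  enorm (x - y) <= L -> reach S L x y.
Proof.
move=> ABCS ABCx ABCy xyL; apply: reach_lerp; last by rewrite enormBC.
by move=> t t01; apply: ABCS; exact: triangle_closed.
Qed.

Lemma reach_adjacent (R : realType) n (S : set 'rV[R]_n) (o A B C D x y : 'rV[R]_n)
    (r : R) : 0 < r ->
    enorm (A - o) <= r -> enorm (B - o) <= r ->
    enorm (C - o) <= r -> enorm (D - o) <= r ->
    triangle A B C `<=` S -> triangle A B D `<=` S ->
    triangle A C D `<=` S -> triangle B C D `<=` S ->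
    triangle A B C x -> triangle A B D y ->
  reach S (23 / 10 * r) x y.
Proof.
move=> r0 Ar Br Cr Dr SABC SABD SACD SBCD ABCx ABDy.
have xr := triangle_ball Ar Br Cr ABCx; have yr := triangle_ball Ar Br Dr ABDy.
have tri (o' a b : 'rV[R]_n) := ler_enormB a o' b.
have via_side w : segment A B w ->
    enorm (x - w) + enorm (w - y) <= 23 / 10 * r ->
    reach S (23 / 10 * r) x y.
  move=> ABw xwy; rewrite -(subrKC (enorm (x - w)) (23 / 10 * r)).
  apply: (@reach_cat _ _ _ _ _ x w y); first exact: enorm_ge0.
  - by have := enorm_ge0 (w - y); lra.
  - by apply: (reach_triangle SABC) => //; exact: segment_triangle.
  - by apply: (reach_triangle SABD) => //; [exact: segment_triangle|lra].
have [[w ABw wx]|[u [v [BCu ACv uv]]]] := triangle_near r0 Ar Br Cr ABCx.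
  (* Here [|w - y| <= |w - o| + r], for a total of at most [13/10 r + r]. *)
  apply: (via_side w ABw); rewrite (enormBC x).
  by have := tri o w y; rewrite (enormBC o y); lra.
have [[w ABw wy]|[u' [v' [BDu' ADv' uv']]]] := triangle_near r0 Ar Br Dr ABDy.
  apply: (via_side w ABw); rewrite (enormBC x).
  by have := tri o w x; rewrite (enormBC o x); lra.
(* With [E] one of [A], [B], the path crosses [ECD] from [a] to [a'], at a cost of at most
   [|a - o| + |a' - o|]. *)
have via_face E (a a' : 'rV[R]_n) : triangle E C D `<=` S ->
    segment E C a -> segment E D a' -> triangle A B C a -> triangle A B D a' ->
    enorm (a - o) + enorm (a - x) + (enorm (a' - o) + enorm (a' - y))
      <= 23 / 10 * r ->
    reach S (23 / 10 * r) x y.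
  move=> SECD ECa EDa' ABCa ABDa' h.
  have aa' := tri o a a'; rewrite (enormBC o) in aa'; rewrite (enormBC a x) in h.
  rewrite -(subrKC (enorm (x - a) + enorm (a - a')) (23 / 10 * r)).
  apply: (@reach_cat _ _ _ _ _ x a' y); first by rewrite addr_ge0 ?enorm_ge0.
  - by have := enorm_ge0 (a' - y); lra.
  - apply: (@reach_cat _ _ _ _ _ x a a'); rewrite ?enorm_ge0//.
      exact: (reach_triangle SABC).
    by apply: (reach_triangle SECD) => //; [exact: segment_triangle|
      exact/triangleACB/segment_triangle].
  - by apply: (reach_triangle SABD) => //; lra.
have [h|h] := leP (enorm (u - o) + enorm (u - x)
    + (enorm (u' - o) + enorm (u' - y))) (23 / 10 * r).
  apply: (via_face B u u') => //.
    by apply/triangleBAC/triangleACB/segment_triangle.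
  by apply/triangleBAC/triangleACB/segment_triangle.
apply: (via_face A v v') => //; last lra.
  by apply/triangleACB/segment_triangle.
by apply/triangleACB/segment_triangle.
Qed.

(** * Convex hulls and the faces of a tetrahedron *)

(** The weight of [conv] goes to its first point and that of [lerp] to the second, hence [1 - t]. *)
Lemma convex_set_lerp (R : realType) n (S : set 'rV[R]_n) :
  convex_set (S : set (convex_lmodType 'rV[R]_n)) -> lerp_closed S.
Proof.
move=> Scv t x y /andP[t0 t1] Sx Sy; have s0 : 0 <= 1 - t by rewrite subr_ge0.
have s1 : 1 - t <= 1 by rewrite gerBl.
have := Scv x y (Itv01 s0 s1); rewrite !inE => /(_ Sx Sy).
by rewrite /conv/= /unstable.onem subKr.
Qed.

Lemma lerp_convex_set (R : realType) n (S : set 'rV[R]_n) :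
  lerp_closed S -> convex_set (S : set (convex_lmodType 'rV[R]_n)).
Proof.
move=> Scl x y t; rewrite !inE => Sx Sy.
have t01 : 0 <= 1 - t%:num <= 1 by rewrite subr_ge0 gerBl ge0 le1.
by have := Scl _ _ _ t01 Sx Sy; rewrite /lerp subKr.
Qed.

Lemma convex_hull_closed (R : realType) n (A : set 'rV[R]_n) :
  lerp_closed (convex_hull A).
Proof.
move=> t x y t01 Ax Ay B [Bcv AB].
by apply: (convex_set_lerp Bcv) => //; [exact: Ax|exact: Ay].
Qed.

Lemma convex_hull_sub (R : realType) n (A S : set 'rV[R]_n) :
  lerp_closed S -> A `<=` S -> convex_hull A `<=` S.
Proof. by move=> Scl AS; apply: smallest_sub => //; exact: lerp_convex_set. Qed.

Definition face (R : realType) (v : 'I_4 -> 'rV[R]_3) (i : 'I_4) :=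
  convex_hull [set v j | j in [set j | j != i]].

Lemma face_vertex (R : realType) (v : 'I_4 -> 'rV[R]_3) (i j : 'I_4) :
  j != i -> face v i (v j).
Proof. by move=> ji; apply: sub_gen_smallest; exists j. Qed.

Lemma face_tetra_surface (R : realType) (v : 'I_4 -> 'rV[R]_3) (i : 'I_4) :
  face v i `<=` tetra_surface v.
Proof. by move=> x ix; exists i. Qed.

Lemma tetra_vertex (R : realType) (v : 'I_4 -> 'rV[R]_3) (i : 'I_4) :
  tetra_surface v (v i).
Proof.
have [j ij] : exists j, i != j.
  by case: i => -[|i] i4; [exists (lift ord0 ord0)|exists ord0].
by apply: (@face_tetra_surface _ _ j); exact: face_vertex.
Qed.

Lemma triangle_face (R : realType) (v : 'I_4 -> 'rV[R]_3) (i j k l : 'I_4) :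
  j != i -> k != i -> l != i -> triangle (v j) (v k) (v l) `<=` face v i.
Proof.
move=> ji ki li x; apply: triangle_sub; first exact: convex_hull_closed.
- exact: face_vertex.
- exact: face_vertex.
- exact: face_vertex.
Qed.

Lemma face_triangle (R : realType) (v : 'I_4 -> 'rV[R]_3) (i j k l : 'I_4) :
    (forall m, m != i -> [|| m == j, m == k | m == l]) ->
  face v i `<=` triangle (v j) (v k) (v l).
Proof.
move=> im; apply: convex_hull_sub; first exact: triangle_closed.
move=> _ [m /= /im /or3P[] /eqP-> <-].
- exact/segment_triangle/segment_l.
- exact/segment_triangle/segment_r.
- exact/triangleACB/segment_triangle/segment_r.
Qed.

(** For the faces opposite to [v i] and [v j], this gives the ends [v k], [v l] of their common
    edge. *)
Lemma other_indices (i j : 'I_4) : i != j ->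
  exists k l : 'I_4, k != l /\
    forall m, (m != i) && (m != j) = (m == k) || (m == l).
Proof.
move=> ij; have /cards2P[k [l [kl E]]] : #|~: [set i; j]%SET| == 2%N.
  by rewrite -(eqn_add2l #|[set i; j]%SET|) cardsC cards2 ij card_ord.
exists k, l; split=> // m.
by have /setP/(_ m) := E; rewrite !inE negb_or.
Qed.

Lemma tetra_surface_ball (R : realType) (v : 'I_4 -> 'rV[R]_3) o (r : R) x :
  (forall i, enorm (v i - o) <= r) -> tetra_surface v x -> enorm (x - o) <= r.
Proof.
move=> vr [i _]; apply: (convex_hull_sub (S := fun x => enorm (x - o) <= r)).
  move=> t y z t01 yr zr; have -> : lerp t y z - o = lerp t (y - o) (z - o).
    by apply/rowP => k; rewrite !mxE; ring.
  by apply: (le_trans (enorm_lerp _ _ t01)); case/andP: t01; nra.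
by move=> _ [j _ <-].
Qed.

(** * Upper bound for the intrinsic diameter *)

Lemma tetra_dist_le (R : realType) (v : 'I_4 -> 'rV[R]_3) o (r : R) x y : 0 < r ->
    (forall i, enorm (v i - o) <= r) -> tetra_surface v x -> tetra_surface v y ->
  (intrinsic_dist (tetra_surface v) x y <= (23 / 10 * r)%:E)%E.
Proof.
move=> r0 vr Sx Sy; apply: reach_dist; first lra.
have xr := tetra_surface_ball vr Sx; have yr := tetra_surface_ball vr Sy.
case: Sx Sy => [i _ ix] [j _ jy]; have [ij|ij] := eqVneq i j.
  (* In a common face the straight segment has length at most [2 r]. *)
  subst j; apply: reach_lerp.
    by move=> t t01; apply: (@face_tetra_surface _ _ i); exact: convex_hull_closed.
  by have := ler_enormB y o x; rewrite (enormBC o); lra.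
have [k [l [kl ijkl]]] := other_indices ij.
have /andP[ki kj] : (k != i) && (k != j) by rewrite ijkl eqxx.
have /andP[li lj] : (l != i) && (l != j) by rewrite ijkl eqxx orbT.
have sub m a b c : a != m -> b != m -> c != m ->
    triangle (v a) (v b) (v c) `<=` tetra_surface v.
  move=> am bm cm z /(triangle_face am bm cm); exact: face_tetra_surface.
apply: (@reach_adjacent _ _ _ o (v k) (v l) (v j) (v i)) => //.
- by apply: (sub i) => //; rewrite eq_sym.
- exact: (sub j).
- by apply: (sub l) => //; rewrite eq_sym.
- by apply: (sub k); rewrite eq_sym.
- apply: face_triangle ix => m mi; have [|mj] := eqVneq m j; first by rewrite !orbT.
  by rewrite orbF -ijkl mi.
- apply: face_triangle jy => m mj; have [|mi] := eqVneq m i; first by rewrite !orbT.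
  by rewrite orbF -ijkl mi.
Qed.

Lemma intrinsic_diameter_le (R : realType) (v : 'I_4 -> 'rV[R]_3) o (r : R) :
    0 < r -> (forall i, enorm (v i - o) <= r) ->
  (intrinsic_diameter (tetra_surface v) <= (23 / 10 * r)%:E)%E.
Proof.
move=> r0 vr; apply: ge_ereal_sup => _ [[x y] [/= Sx Sy] <-].
exact: (tetra_dist_le (o := o)).
Qed.

(** * Comparison of radius and diameter *)

Lemma edge_le_diameter (R : realType) (v : 'I_4 -> 'rV[R]_3) (i j : 'I_4) :
  ((enorm (v i - v j))%:E <= intrinsic_diameter (tetra_surface v))%E.
Proof.
apply: (le_trans (dist_ge (tetra_surface v) _ _)).
by apply: ereal_sup_ubound; exists (v i, v j) => //; split; exact: tetra_vertex.
Qed.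

(** A matrix with a zero row has no right inverse. *)
Lemma affinely_independent_edge (R : realType) (v : 'I_4 -> 'rV[R]_3) :
  affinely_independent v -> 0 < enorm (v (lift ord0 ord0) - v ord0).
Proof.
move=> vfree; rewrite lt_neqAle enorm_ge0 andbT eq_sym; apply/eqP => /enorm_eq0 v0.
have := row_freeP vfree => -[B /(congr1 (row ord0))].
rewrite row_mul rowK v0 mul0mx => /rowP/(_ ord0)/eqP.
by rewrite !mxE eqxx eq_sym oner_eq0.
Qed.

(** For each centre [c] on the surface, the ball whose radius is the supremum contains the vertices,
    so the diameter bound applies to it. *)
Lemma extrinsic_radius_ge (R : realType) (v : 'I_4 -> 'rV[R]_3) (d : R) :
    0 < enorm (v (lift ord0 ord0) - v ord0) ->
    intrinsic_diameter (tetra_surface v) = d%:E ->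
  ((10 / 23 * d)%:E <= extrinsic_radius (tetra_surface v))%E.
Proof.
move=> v0 dE; apply/ereal_infP => _ [c Sc <-].
have supv i : ((enorm (v i - c))%:E <=
    ereal_sup [set (enorm (c - y))%:E | y in tetra_surface v])%E.
  rewrite enormBC; apply: ereal_sup_ubound; exists (v i) => //.
  exact: tetra_vertex.
move: (ereal_sup _) supv => [r| |] supv; last 2 first.
- by rewrite leey.
- by have := supv ord0; rewrite leeNy_eq.
have {}supv i : enorm (v i - c) <= r by rewrite -lee_fin.
have r0 : 0 < r.
  have := ler_enormB (v (lift ord0 ord0)) c (v ord0); rewrite (enormBC c).
  by have := supv ord0; have := supv (lift ord0 ord0); lra.
by have := intrinsic_diameter_le r0 supv; rewrite dE !lee_fin; lra.
Qed.

Lemma longest_edge (R : realType) (v : 'I_4 -> 'rV[R]_3) :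
  exists i j, forall k l, enorm (v k - v l) <= enorm (v i - v j).
Proof.
pose f (p : 'I_4 * 'I_4) := enorm (v p.1 - v p.2).
case: (@arg_maxP _ _ _ (ord0, ord0) predT f) => // -[i j] _ ij.
by exists i, j => k l; exact: (ij (k, l)).
Qed.

(* The median theorem: the midpoint of a longest edge, of length [L], is within
   [sqrt 3 / 2 * L <= 9 / 10 * L] of all vertices. *)
Lemma extrinsic_radius_le (R : realType) (v : 'I_4 -> 'rV[R]_3) i j :
    0 < enorm (v i - v j) ->
    (forall k l, enorm (v k - v l) <= enorm (v i - v j)) ->
  (extrinsic_radius (tetra_surface v) <= (9 / 10 * enorm (v i - v j))%:E)%E.
Proof.
move=> L0 Lmax; have ij : i != j.
  by apply: contraTneq L0 => ->; rewrite subrr enorm0 ltxx.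
have [k [l [_ ijk]]] := other_indices ij.
have /andP[ki kj] : (k != i) && (k != j) by rewrite ijk eqxx.
have half : 0 <= (2^-1 : R) <= 1 by lra.
pose m := lerp 2^-1 (v i) (v j).
have Sm : tetra_surface v m.
  (* The face opposite to [v k] contains the edge from [v i] to [v j]. *)
  apply: (@face_tetra_surface _ _ k).
  by apply: convex_hull_closed => //; apply: face_vertex; rewrite eq_sym.
have mv c : enorm (v c - m) <= 9 / 10 * enorm (v i - v j).
  rewrite (enormBC (v c)) -(@ler_pXn2r _ 2)// ?nnegrE ?enorm_ge0 ?mulr_ge0 ?enorm_ge0//.
  have -> : m - v c = lerp 2^-1 (v i - v c) (v j - v c).
    by apply/rowP => a; rewrite !mxE; lra.
  rewrite sqr_enorm_lerp opprB addrA subrK.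
  have sqrL a : enorm (v a - v c) ^+ 2 <= enorm (v i - v j) ^+ 2.
    by rewrite ler_pXn2r ?nnegrE ?enorm_ge0.
  rewrite exprMn; have := sqrL i; have := sqrL j.
  by have := sqr_ge0 (enorm (v i - v j)); lra.
apply: (@le_trans _ _ (ereal_sup [set (enorm (m - y))%:E | y in tetra_surface v])).
  by apply: ereal_inf_lbound; exists m.
apply: ge_ereal_sup => _ [y Sy <-]; rewrite lee_fin (enormBC m).
exact: (tetra_surface_ball mv Sy).
Qed.

Unset Implicit Arguments.

Theorem corollary2 (R : realType) (T : set 'rV[R]_3) (hT : is_tetrahedron T) :
  Num.sqrt 3 / 4
    < fine (extrinsic_radius T) / fine (intrinsic_diameter T) < 1.
Proof.
have [v /affinely_independent_edge v0 ->] := hT.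
have [i [j Lmax]] := longest_edge v.
have L0 : 0 < enorm (v i - v j) := lt_le_trans v0 (Lmax _ _).
have := edge_le_diameter v i j.
(* The ball about [v i] with the longest edge as radius contains all vertices, so the diameter is
   finite. *)
have := intrinsic_diameter_le L0 (Lmax^~ i).
have := extrinsic_radius_ge v0; have := extrinsic_radius_le L0 Lmax.
case: (intrinsic_diameter _) => [d| |]; rewrite ?leye_eq ?leeNy_eq//.
move=> + /(_ d erefl).
case: (extrinsic_radius _) => [r| |]; rewrite ?leye_eq ?leeNy_eq//.
rewrite !lee_fin /= => rL dr _ Ld.
have d0 : 0 < d := lt_le_trans L0 Ld.
(* Since [(40 / 23)^2 = 1600 / 529 > 3], the constant [sqrt 3 / 4] is below [10 / 23]. *)
have s3 : Num.sqrt 3 < 40 / 23 :> R.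
  rewrite -(@ltr_pXn2r _ 2)// ?nnegrE ?sqrtr_ge0 ?divr_ge0//.
  by rewrite sqr_sqrtr//; lra.
rewrite ltr_pdivlMr// ltr_pdivrMr// mul1r; apply/andP; split; last by lra.
by apply: lt_le_trans dr; rewrite ltr_pM2r//; lra.
Qed.
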